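(* Let $M\models\mathsf{ZFC}$ be $(\mathsf{GBc}+\mathsf{ETR})$-realizable. Then $M$ has a basis of minimal $(\mathsf{GBc}+\mathsf{ETR})$-realizations, where amalgamable $(\mathsf{GBc}+\mathsf{ETR})$-realizations sit above the same basis element. That is, there is a set of ($\subseteq$-minimal) $(\mathsf{GBc}+\mathsf{ETR})$-realizations for $M$, whose elements are called basis elements, satisfying the following. (1) The elements of the basis are pairwise non-amalgamable. (2) If $\mathcal Y$ is any $(\mathsf{GBc}+\mathsf{ETR})$-realization for $M$ then there is a unique basis element $\mathcal B$ so that $\mathcal Y\supseteq\mathcal B$. (3) If $\mathcal X$ and $\mathcal Y$ are amalgamable $(\mathsf{GBc}+\mathsf{ETR})$-realizations for $M$ then they sit above (contain) the same basis element $\mathcal B$.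
   Context: Second-order set theory is formalized in two-sorted first-order logic (sets and classes). A model is a pair $(M,\mathcal X)$ with $M$ the universe of sets (possibly ill-founded) and $\mathcal X\subseteq\mathcal P(M)$ the classes. A formula is first-order if it has no class quantifiers. $\mathsf{GBc}$: $\mathsf{ZFC}$ for sets, Extensionality for classes, Class Replacement (if $F$ is a class function and $a$ a set then $F''a$ is a set), and Elementary Comprehension (Comprehension for first-order formulas with set and class parameters); no Global Choice. $\mathsf{GBc}^-$ is the same with $\mathsf{ZFC}$ for sets replaced by $\mathsf{ZFC}^-$ (Extensionality, Pairing, Union, Infinity, Foundation, Choice, Separation, Collection). $\mathsf{ETR}$: for each first-order $\phi(x,Y,A)$, class $A$ and well-founded class relation $R$ with transitive closure $<_R$ there is a class $S\subseteq\operatorname{dom}R\times V$ with $(S)_r=\{x:\phi(x,S\restriction r,A)\}$ for all $r\in\operatorname{dom}R$, where $(S)_r=\{x:(r,x)\in S\}$ and $S\restriction r=S\cap(\{r'\in\operatorname{dom}R:r'<_R r\}\times V)$. A $T$-realization for $M$ is a set $\mathcal X\subseteq\mathcal P(M)$ with $(M,\mathcal X)\models T$, and $M$ is $T$-realizable if it has one. Two $T$-realizations $\mathcal X,\mathcal Y$ for $M$ are amalgamable if there is a $\mathsf{GBc}^-$-realization $\mathcal Z$ for $M$ with $\mathcal X,\mathcal Y\subseteq\mathcal Z$. *)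

(* Defs.v *)
From mathcomp Require Import all_boot.
From mathcomp Require Import boolp classical_sets.

Set Implicit Arguments.
Unset Strict Implicit.
Unset Printing Implicit Defensive.

Local Open Scope classical_set_scope.

(* First-order formulas (no class quantifiers) of the two-sorted language, in
   de Bruijn style: [n] free set variables, [m] free class variables, and the
   quantifier binds set variable 0.  The formulas of the language of set theory
   are those with m = 0. *)
Inductive fml (m : nat) : nat -> Type :=
| FEq n of 'I_n & 'I_n : fml m n
| FIn n of 'I_n & 'I_n : fml m n
| FCEq n of 'I_m & 'I_m : fml m n
| FCIn n of 'I_n & 'I_m : fml m n
| FBot n : fml m n
| FImp n of fml m n & fml m n : fml m n
| FAll n of fml m n.+1 : fml m n.

(* Throughout, a model is (M, X) with M = (U, E), where E need not be
   well-founded, and X : set (set U).  The sorts are separate, so a set is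
   never literally a class, and equality is true equality. *)
Fixpoint sat (U : Type) (E : U -> U -> Prop) (m : nat) (P : m.-tuple (set U))
    (n : nat) (f : fml m n) : n.-tuple U -> Prop :=
  match f in fml _ n return n.-tuple U -> Prop with
  | FEq _ i j => fun e => tnth e i = tnth e j
  | FIn _ i j => fun e => E (tnth e i) (tnth e j)
  | FCEq _ i j => fun=> tnth P i = tnth P j
  | FCIn _ i j => fun e => tnth P j (tnth e i)
  | FBot _ => fun=> False
  | FImp _ g h => fun e => sat E P g e -> sat E P h e
  | FAll _ g => fun e => forall x, sat E P g [tuple of x :: e]
  end.

Record ZFCminus (U : Type) (E : U -> U -> Prop) : Prop := {
  zf_ext : forall a b, (forall z, E z a <-> E z b) -> a = b;
  zf_pair : forall a b, exists c, forall z, E z c <-> z = a \/ z = b;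
  zf_union : forall a, exists c, forall z, E z c <-> exists2 y, E y a & E z y;
  zf_infinity : exists w,
    (exists2 o, E o w & forall z, ~ E z o) /\
    (forall x, E x w -> exists2 s, E s w & forall z, E z s <-> E z x \/ z = x);
  zf_foundation : forall a, (exists x, E x a) ->
    exists2 x, E x a & forall z, E z x -> ~ E z a;
  zf_choice : forall a,
    (forall x, E x a -> exists z, E z x) ->
    (forall x y z, E x a -> E y a -> E z x -> E z y -> x = y) ->
    exists c, forall x, E x a -> exists! z, E z x /\ E z c;
  zf_separation : forall n (f : fml 0 n.+1) (p : n.-tuple U) a,
    exists b, forall x,
      E x b <-> E x a /\ sat E [tuple] f [tuple of x :: p];
  zf_collection : forall n (f : fml 0 n.+2) (p : n.-tuple U) a,
    (forall x, E x a -> exists y, sat E [tuple] f [tuple of x :: y :: p]) ->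
    exists b, forall x, E x a ->
      exists2 y, E y b & sat E [tuple] f [tuple of x :: y :: p]
}.

Definition powerset_axiom (U : Type) (E : U -> U -> Prop) : Prop :=
  forall a, exists c, forall b, E b c <-> (forall z, E z b -> E z a).

Definition ZFC (U : Type) (E : U -> U -> Prop) : Prop :=
  ZFCminus E /\ powerset_axiom E.

(* p is the Kuratowski pair {{a}, {a, b}} as computed in (U, E). *)
Definition is_opair (U : Type) (E : U -> U -> Prop) (p a b : U) : Prop :=
  forall z, E z p <->
    (forall w, E w z <-> w = a) \/ (forall w, E w z <-> w = a \/ w = b).

Definition crel (U : Type) (E : U -> U -> Prop) (R : set U) (a b : U) : Prop :=
  exists2 p, is_opair E p a b & R p.

Definition class_relation (U : Type) (E : U -> U -> Prop) (R : set U) : Prop :=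
  forall p, R p -> exists a b, is_opair E p a b.

Definition class_function (U : Type) (E : U -> U -> Prop) (F : set U) : Prop :=
  class_relation E F /\
  (forall a b c, crel E F a b -> crel E F a c -> b = c).

Section SecondOrderAxioms.
Variables (U : Type) (E : U -> U -> Prop) (X : set (set U)).

Definition class_extensionality : Prop :=
  forall A B, X A -> X B -> (forall x, A x <-> B x) -> A = B.

Definition class_replacement : Prop :=
  forall F a, X F -> class_function E F ->
    exists b, forall y, E y b <-> exists2 x, E x a & crel E F x y.

Definition elementary_comprehension : Prop :=
  forall m n (f : fml m n.+1) (P : m.-tuple (set U)) (p : n.-tuple U),
    (forall i, X (tnth P i)) ->
    exists2 C, X C & forall x, C x <-> sat E P f [tuple of x :: p].

Definition GBcminus : Prop :=
  [/\ ZFCminus E, class_extensionality, class_replacement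
    & elementary_comprehension].

Definition GBc : Prop :=
  [/\ ZFC E, class_extensionality, class_replacement
    & elementary_comprehension].

(* The domain of a relation in the order-theoretic sense (its field), so that
   the maximal elements of R belong to it. *)
Definition rel_dom (R : set U) : set U :=
  [set r | exists s, crel E R r s \/ crel E R s r].

(* Well-foundedness and transitive closure are those of (U, X): all classes
   range over X.  When E is ill-founded these differ from the external notions;
   in particular tclosure is not the closure under standardly finite chains. *)
Definition class_wf (R : set U) : Prop :=
  forall A, X A -> (exists x, A x) ->
    exists2 x, A x & forall y, A y -> ~ crel E R y x.

Definition tclosure (R : set U) (a b : U) : Prop :=
  forall T, X T -> class_relation E T ->
    (forall x y z, crel E T x y -> crel E T y z -> crel E T x z) ->
    R `<=` T -> crel E T a b.

Definition section (S : set U) (r : U) : set U := [set x | crel E S r x].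

Definition restr (R S : set U) (r : U) : set U :=
  [set p | S p /\
    exists r' x, [/\ is_opair E p r' x, rel_dom R r' & tclosure R r' r]].

(* In f, set variable 0 is x, class variables 0 and 1 are Y and A. *)
Definition ETR : Prop :=
  forall (f : fml 2 1) (A R : set U),
    X A -> X R -> class_relation E R -> class_wf R ->
    exists S : set U,
      [/\ X S,
          (forall p, S p -> exists r x, rel_dom R r /\ is_opair E p r x)
        & forall r, rel_dom R r ->
            section S r = [set x | sat E [tuple restr R S r; A] f [tuple x]]].

Definition GBcETR : Prop := GBc /\ ETR.

End SecondOrderAxioms.

Definition realizable (U : Type) (T : set (set U) -> Prop) : Prop :=
  exists X, T X.

Definition amalgamable (U : Type) (E : U -> U -> Prop) (X Y : set (set U)) :
    Prop :=
  exists Z, [/\ GBcminus E Z, X `<=` Z & Y `<=` Z].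

Definition minimal_realization (U : Type) (T : set (set U) -> Prop)
    (B : set (set U)) : Prop :=
  T B /\ forall X, T X -> X `<=` B -> X = B.

(* Main.v *)
Require Import Defs.
From mathcomp Require Import all_boot.
From mathcomp Require Import boolp classical_sets.

Local Open Scope classical_set_scope.

(* If all members of a nonempty family of (GBc+ETR)-realizations are contained
   in one GBc-realization Z of M, then their intersection is again a
   (GBc+ETR)-realization.  Elementary comprehension and class replacement pass
   to the intersection because first-order formulas are evaluated independently
   of the classes.  For ETR one needs that the well-foundedness of a class
   relation R and its transitive closure do not depend on the realization: R is
   well-founded iff every nonempty set has an R-minimal element, and the
   transitive closure is definable by quantifying over sets only.  Solutions of
   a recursion are then unique in Z, so the members of the family share them.
   The basis consists of all minimal realizations; the one below X is the
   intersection of all realizations contained in X, and if X and Y are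
   amalgamable then the intersection of X and Y contains a basis element. *)

Set Implicit Arguments.
Unset Strict Implicit.
Unset Printing Implicit Defensive.

(** * Definable predicates *)

(** Places two formulas over one concatenated tuple of class parameters, so that connectives can
    combine them. *)
Fixpoint class_rename m m' (g : 'I_m -> 'I_m') n (f : fml m n) : fml m' n :=
  match f in fml _ n return fml m' n with
  | FEq _ i j => FEq m' i j
  | FIn _ i j => FIn m' i j
  | FCEq n i j => FCEq n (g i) (g j)
  | FCIn _ i j => FCIn i (g j)
  | FBot n => FBot m' n
  | FImp _ a b => FImp (class_rename g a) (class_rename g b)
  | FAll _ a => FAll (class_rename g a)
  end.

Lemma sat_class_rename (U : Type) (E : U -> U -> Prop) m m'
    (g : 'I_m -> 'I_m') (P : m.-tuple (set U)) (P' : m'.-tuple (set U)) :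
  (forall i, tnth P' (g i) = tnth P i) ->
  forall n (f : fml m n) e, sat E P' (class_rename g f) e <-> sat E P f e.
Proof.
move=> gP n; elim=> {n} //=.
- by move=> n i j e; rewrite !gP.
- by move=> n i j e; rewrite gP.
- by move=> n a IHa b IHb e; split=> + /IHa => /[apply] /IHb.
- by move=> n a IHa e; split=> h x; apply/IHa.
Qed.

Definition tbehead n (T : Type) (e : n.+1.-tuple T) : n.-tuple T :=
  [tuple of behead e].

Section Definability.
Variables (U : Type) (E : U -> U -> Prop) (X : set (set U)).

(* There are no set parameters: a fixed set a enters through the classes
   {x | x in a}, {x | a in x} and {a}, see definable_in and definable_eq. *)
Definition definable n (Q : n.-tuple U -> Prop) : Prop :=
  exists m (P : m.-tuple (set U)) (f : fml m n),
    (forall i, X (tnth P i)) /\ forall e, Q e <-> sat E P f e.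

Definition term n (t : n.-tuple U -> U) : Prop :=
  (exists i, forall e, t e = tnth e i) \/ (exists a, forall e, t e = a).

(** Quantifying over all contexts and terms builds substitution into the notion, so set variables of
    formulas are never renamed. Constant terms supply set parameters. *)
Definition definable1 (Q : U -> Prop) : Prop :=
  forall n (s : n.-tuple U -> U), term s -> definable (fun e => Q (s e)).

Definition definable2 (Q : U -> U -> Prop) : Prop :=
  forall n (s t : n.-tuple U -> U), term s -> term t ->
    definable (fun e => Q (s e) (t e)).

(** Each quantifier lengthens the environment; a selection recovers the outer environment from the
    longer one. *)
Definition selection n k (u : n.-tuple U -> k.-tuple U) : Prop :=
  exists g, forall e i, tnth (u e) i = tnth e (g i).

Lemma selection_id n : selection (fun e : n.-tuple U => e).
Proof. by exists id. Qed.

Lemma selection_behead n k (u : n.-tuple U -> k.+1.-tuple U) :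
  selection u -> selection (fun e => tbehead (u e)).
Proof.
move=> [g ug]; exists (fun i => g (lift ord0 i)) => e i.
by rewrite -ug [in RHS](tuple_eta (u e)) tnthS.
Qed.

Lemma term_head n : term (@thead n U).
Proof. by left; exists ord0. Qed.

Lemma term_select n k (t : k.-tuple U -> U) (u : n.-tuple U -> k.-tuple U) :
  term t -> selection u -> term (fun e => t (u e)).
Proof.
move=> [[i ti]|[a ta]] [g ug]; last by right; exists a.
by left; exists (g i) => e; rewrite ti ug.
Qed.

Lemma term_const n a : term (fun _ : n.-tuple U => a).
Proof. by right; exists a. Qed.

Lemma definable_ext n (Q Q' : n.-tuple U -> Prop) :
  (forall e, Q e <-> Q' e) -> definable Q' -> definable Q.
Proof.
move=> QQ' [m [P [f [XP hf]]]]; exists m, P, f; split=> // e.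
by rewrite QQ' hf.
Qed.

Lemma definable_imp n (A B : n.-tuple U -> Prop) :
  definable A -> definable B -> definable (fun e => A e -> B e).
Proof.
move=> [m [P [f [XP hf]]]] [m' [P' [f' [XP' hf']]]].
exists (m + m'), [tuple of P ++ P'],
  (FImp (class_rename (@lshift m m') f) (class_rename (@rshift m m') f')).
split=> [i|e /=].
  by case: (split_ordP i) => j ->; rewrite ?tnth_lshift ?tnth_rshift.
have hl := @sat_class_rename U E _ _ (@lshift m m') P [tuple of P ++ P']
  (fun i => tnth_lshift P P' i) _ f e.
have hr := @sat_class_rename U E _ _ (@rshift m m') P' [tuple of P ++ P']
  (fun i => tnth_rshift P P' i) _ f' e.
by rewrite hf hf'; split=> h /hl/h/hr.
Qed.

Lemma definable_all n (A : n.-tuple U -> U -> Prop) :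
  definable (fun e : n.+1.-tuple U => A (tbehead e) (thead e)) ->
  definable (fun e => forall x, A e x).
Proof.
move=> [m [P [f [XP hf]]]]; exists m, P, (FAll f); split=> // e /=.
have h x : A e x <-> sat E P f [tuple of x :: e].
  rewrite -hf theadE; have -> // : tbehead [tuple of x :: e] = e.
  exact: val_inj.
by split=> H x; apply/h.
Qed.

Lemma definable_false n : definable (fun _ : n.-tuple U => False).
Proof. by exists 0, [tuple], (FBot 0 n); split=> // -[]. Qed.

Lemma definable_not n (A : n.-tuple U -> Prop) :
  definable A -> definable (fun e => ~ A e).
Proof. by move=> h; apply: definable_imp h (definable_false _). Qed.

Lemma definable_true n : definable (fun _ : n.-tuple U => True).
Proof.
apply: definable_ext (definable_not (definable_false n)) => e.
by split=> // _ [].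
Qed.

Lemma definable_prop n (A : Prop) : definable (fun _ : n.-tuple U => A).
Proof.
case: (pselect A) => hA; [apply: definable_ext (definable_true _)|
  apply: definable_ext (definable_false _)]; by move=> e; split.
Qed.

Lemma definable_or n (A B : n.-tuple U -> Prop) :
  definable A -> definable B -> definable (fun e => A e \/ B e).
Proof.
move=> hA hB; apply: definable_ext (definable_imp (definable_not hA) hB) => e.
split=> [[]//|h]; by case: (pselect (A e)) => [|/h]; [left|right].
Qed.

Lemma definable_and n (A B : n.-tuple U -> Prop) :
  definable A -> definable B -> definable (fun e => A e /\ B e).
Proof.
move=> hA hB.
apply: definable_ext (definable_not (definable_imp hA (definable_not hB))) => e.
split=> [[a b] /(_ a b)//|h]; apply: contrapT => h'.
by apply: h => a b; apply: h'.
Qed.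

Lemma definable_iff n (A B : n.-tuple U -> Prop) :
  definable A -> definable B -> definable (fun e => A e <-> B e).
Proof. by move=> hA hB; apply: definable_and; apply: definable_imp. Qed.

Lemma definable_ex n (A : n.-tuple U -> U -> Prop) :
  definable (fun e : n.+1.-tuple U => A (tbehead e) (thead e)) ->
  definable (fun e => exists x, A e x).
Proof.
move=> /definable_not h.
apply: definable_ext (definable_not (@definable_all n (fun e x => ~ A e x) h)).
by move=> e; rewrite -existsNE; split=> -[x hx]; exists x => //; apply: contrapT.
Qed.

Lemma definable_ex2 n (A B : n.-tuple U -> U -> Prop) :
  definable (fun e : n.+1.-tuple U => A (tbehead e) (thead e)) ->
  definable (fun e : n.+1.-tuple U => B (tbehead e) (thead e)) ->
  definable (fun e => exists2 x, A e x & B e x).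
Proof.
move=> hA hB; apply: (@definable_ext _ _ (fun e => exists x, A e x /\ B e x)).
  by move=> e; split=> -[x]; [exists x|case; exists x].
by apply: definable_ex; apply: definable_and.
Qed.

Lemma definable_class (C : set U) : X C -> definable1 C.
Proof.
move=> XC n t [[i ti]|[a ta]]; last first.
  by apply: definable_ext (definable_prop _ (C a)) => e; rewrite ta.
exists 1, [tuple C], (FCIn i ord0); split=> [j|e /=]; first by rewrite ord1.
by rewrite ti.
Qed.

Hypothesis XC : elementary_comprehension E X.

Lemma comprehension (Q : set U) :
  definable (fun e : 1.-tuple U => Q (thead e)) -> X Q.
Proof.
move=> [m [P [f [XP hf]]]].
have [C XC' hC] := XC f [tuple] XP.
suff -> : Q = C by [].
by apply/funext => x; apply/propext; rewrite hC -hf.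
Qed.

(** Elementary comprehension with set parameter [p] makes [Q] a class of [X], which then replaces
    the parameter. *)
Lemma class_of_binary n (f : fml 0 2) (p : U) (Q : set U) :
  (forall x, Q x <-> sat E [tuple] f [tuple x; p]) ->
  forall t : n.-tuple U -> U, term t -> definable (fun e => Q (t e)).
Proof.
move=> hQ; apply: definable_class.
have [|C XC' hC] := XC f (P := [tuple]) [tuple p]; first by case.
suff -> : Q = C by [].
by apply/funext => x; apply/propext; rewrite hC hQ.
Qed.

Lemma definable_in : definable2 E.
Proof.
move=> n s t hs ht; case: (hs) => [[i si]|[a sa]].
  case: ht => [[j tj]|[b tb]].
    exists 0, [tuple], (FIn 0 i j); split=> [[]//|e /=]; by rewrite si tj.
  apply: definable_ext (@class_of_binary n (FIn 0 ord0 (lift ord0 ord0)) b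
    (fun x => E x b) _ s hs) => [e|x//].
  by rewrite tb.
apply: definable_ext (@class_of_binary n (FIn 0 (lift ord0 ord0) ord0) a
  (fun x => E a x) _ t ht) => [e|x//].
by rewrite sa.
Qed.

Lemma definable_eq : definable2 eq.
Proof.
move=> n s t hs ht; case: (hs) => [[i si]|[a sa]].
  case: ht => [[j tj]|[b tb]].
    exists 0, [tuple], (FEq 0 i j); split=> [[]//|e /=]; by rewrite si tj.
  apply: definable_ext (@class_of_binary n (FEq 0 ord0 (lift ord0 ord0)) b
    (fun x => x = b) _ s hs) => [e|x//].
  by rewrite tb.
apply: definable_ext (@class_of_binary n (FEq 0 (lift ord0 ord0) ord0) a
  (fun x => a = x) _ t ht) => [e|x//].
by rewrite sa.
Qed.

End Definability.

Ltac term_tac := lazymatch goal with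
  | |- term (fun _ => ?a) => exact: term_const
  | |- term (fun e => ?t (@?u e)) =>
      refine (@term_select _ _ _ t u _ _); [term_tac | term_tac]
  | |- term _ => first [assumption | exact: term_head]
  | |- selection (fun e => e) => exact: selection_id
  | |- selection (fun e => tbehead (@?u e)) =>
      refine (@selection_behead _ _ _ u _); term_tac
  end.

Ltac definable_tac := cbv beta; lazymatch goal with
  | |- term _ => term_tac
  | |- definable1 _ _ _ => let n := fresh "n" in let s := fresh "s" in
      let hs := fresh "hs" in move=> n s hs; definable_tac
  | |- definable2 _ _ _ => let n := fresh "n" in let s := fresh "s" in
      let t := fresh "t" in let hs := fresh "hs" in let ht := fresh "ht" in
      move=> n s t hs ht; definable_tac
  | |- definable _ _ (fun _ => ?A) => exact: definable_prop
  | |- definable _ _ (fun e => ~ @?A e) =>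
      refine (@definable_not _ _ _ _ A _); definable_tac
  | |- definable _ _ (fun e => @?A e /\ @?B e) =>
      refine (@definable_and _ _ _ _ A B _ _); definable_tac
  | |- definable _ _ (fun e => @?A e \/ @?B e) =>
      refine (@definable_or _ _ _ _ A B _ _); definable_tac
  | |- definable _ _ (fun e => @?A e <-> @?B e) =>
      refine (@definable_iff _ _ _ _ A B _ _); definable_tac
  | |- definable _ _ (fun e => exists x, @?A e x) =>
      refine (@definable_ex _ _ _ _ A _); definable_tac
  | |- definable _ _ (fun e => exists2 x, @?A e x & @?B e x) =>
      refine (@definable_ex2 _ _ _ _ A B _ _); definable_tac
  | |- definable _ _ (fun e => @?s e = @?t e) =>
      refine (@definable_eq _ _ _ _ _ s t _ _);
        [eassumption | term_tac | term_tac]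
  | |- definable _ _ (fun e => forall x : ?U, @?A e x) =>
      (* An implication whose premise does not depend on [e] also matches this pattern; the second
         alternative treats it. *)
      first [ refine (@definable_all _ _ _ _ A _); definable_tac
            | lazymatch goal with
              | |- definable _ _ (fun e => @?B e -> @?C e) =>
                  refine (@definable_imp _ _ _ _ B C _ _); definable_tac
              end ]
  | |- definable _ _ (fun e => @?B e -> @?C e) =>
      refine (@definable_imp _ _ _ _ B C _ _); definable_tac
  | |- definable _ _ (fun e => is_opair _ (@?p e) (@?a e) (@?b e)) =>
      rewrite /is_opair; definable_tac
  | |- definable _ _ (fun e => crel _ ?R (@?s e) (@?t e)) =>
      rewrite /crel; definable_tac
  | |- definable _ _ (fun e => ?Q (@?s e) (@?t e)) =>
      first [ match goal with H : definable2 _ _ Q |- _ =>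
                refine (H _ s t _ _); term_tac end
            | refine (@definable_in _ _ _ _ _ s t _ _);
                [assumption | term_tac | term_tac]
            | unfold Q; definable_tac ]
  | |- definable _ _ (fun e => ?Q (@?s e)) =>
      first [ match goal with H : definable1 _ _ Q |- _ =>
                refine (H _ s _); term_tac end
            | refine (@definable_class _ _ _ Q _ _ s _); [assumption | term_tac]
            | unfold Q; definable_tac ]
  | |- _ => assumption
  end.

(** * Iteration, foundation and ranks inside a realization *)

Section SetTheory.
Variables (U : Type) (E : U -> U -> Prop) (X : set (set U)).
Hypotheses (ZF : ZFC E) (XR : class_replacement E X)
  (XC : elementary_comprehension E X).

Local Notation "x ∈ y" := (E x y) (at level 70).
Local Notation definable1 := (definable1 E X).
Local Notation definable2 := (definable2 E X).

Let ext : forall a b, (forall z, E z a <-> E z b) -> a = b := zf_ext ZF.1.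

(** * Pairs, replacement and separation for definable predicates *)

Lemma singleton_ex a : exists c, forall z, z ∈ c <-> z = a.
Proof.
have [c hc] := zf_pair ZF.1 a a; exists c => z.
by rewrite hc; split=> [[]|->]; [| |left].
Qed.

Lemma union2_ex a b : exists c, forall z, z ∈ c <-> z ∈ a \/ z ∈ b.
Proof.
have [p hp] := zf_pair ZF.1 a b; have [c hc] := zf_union ZF.1 p.
exists c => z; rewrite hc; split=> [[y /hp[->|->]]|[h|h]]; [by left|by right| |].
- by exists a => //; apply/hp; left.
- by exists b => //; apply/hp; right.
Qed.

Lemma is_opair_ex a b : exists p, is_opair E p a b.
Proof.
have [s hs] := singleton_ex a; have [d hd] := zf_pair ZF.1 a b.
have [p hp] := zf_pair ZF.1 s d; exists p => z; rewrite hp.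
split=> [[->|->]|[h|h]]; [by left|by right|left|right]; apply: ext => w.
- by rewrite h hs.
- by rewrite h hd.
Qed.

Lemma is_opair_uniq p q a b : is_opair E p a b -> is_opair E q a b -> p = q.
Proof. by move=> hp hq; apply: ext => z; rewrite hp hq. Qed.

Lemma is_opair_inj p a b c d :
  is_opair E p a b -> is_opair E p c d -> a = c /\ b = d.
Proof.
move=> hab hcd.
have [s hs] := singleton_ex a; have [t ht] := zf_pair ZF.1 a b.
have [s' hs'] := singleton_ex c; have [t' ht'] := zf_pair ZF.1 c d.
have /hcd sp : s ∈ p by apply/hab; left.
have /hcd tp : t ∈ p by apply/hab; right.
have /hab sp' : s' ∈ p by apply/hcd; left.
have /hab tp' : t' ∈ p by apply/hcd; right.
have ac : a = c.
  by case: sp => /(_ c); rewrite hs => h; apply/esym/h; [|left].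
subst c; split=> //.
have bad : b = a \/ b = d.
  case: tp => /(_ b); rewrite ht => -[h _]; last by apply: h; right.
  by left; apply: h; right.
have dab : d = a \/ d = b.
  case: tp' => /(_ d); rewrite ht' => -[h _]; last by apply: h; right.
  by left; apply: h; right.
by case: bad => // ba; case: dab => // da; rewrite ba da.
Qed.

Lemma crel_opair p (R : set U) a b : is_opair E p a b -> crel E R a b <-> R p.
Proof.
move=> hp; split=> [[q hq Rq]|Rp]; last by exists p.
by rewrite (is_opair_uniq hp hq).
Qed.

Lemma replacement (Q : U -> U -> Prop) a : definable2 Q ->
  (forall x y y', x ∈ a -> Q x y -> Q x y' -> y = y') ->
  exists b, forall y, y ∈ b <-> exists2 x, x ∈ a & Q x y.
Proof.
move=> dQ funQ.
(* Restricting the arguments to [a] turns functionality on [a] into functionality of the whole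
   class. *)
pose F : set U := fun p => exists x y, is_opair E p x y /\ x ∈ a /\ Q x y.
have FE x y : crel E F x y <-> x ∈ a /\ Q x y.
  split=> [[p hp [x' [y' [hp']]]]|h].
    by have [-> ->] := is_opair_inj hp hp'.
  by have [p hp] := is_opair_ex x y; exists p => //; exists x, y.
have XF : X F by apply: (comprehension XC); rewrite /F; definable_tac.
have Ffun : class_function E F.
  split=> [p [x [y [hp _]]]|x y y' /FE[xa xy] /FE[_ xy']]; first by exists x, y.
  exact: funQ xy xy'.
have [b hb] := @XR F a XF Ffun.
exists b => y; rewrite hb.
by split=> -[x xa h]; exists x => //; [case/FE: h|apply/FE].
Qed.

(** Replacement along the identity restricted to [Q]. *)
Lemma class_separation (Q : U -> Prop) a : definable1 Q ->
  exists b, forall x, x ∈ b <-> x ∈ a /\ Q x.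
Proof.
move=> dQ; have [||b hb] := @replacement (fun x y => x = y /\ Q x) a.
- definable_tac.
- by move=> x y y' _ [<-] _ [<-].
exists b => y; rewrite hb.
by split=> [[x xa [<-]]|[ya Qy]]; [|exists y].
Qed.

(** Replacement yields each row, with [x] fixed, and then the set of all rows; [d] is the union of
    the rows. *)
Lemma product_ex (Q : U -> U -> Prop) a : definable2 Q ->
  exists d, forall p, p ∈ d <->
    exists x y, is_opair E p x y /\ [/\ x ∈ a, y ∈ a & Q x y].
Proof.
move=> dQ.
pose row x z := forall p, p ∈ z <->
  exists y, is_opair E p x y /\ y ∈ a /\ Q x y.
have [||r hr] := @replacement row a; first by rewrite /row; definable_tac.
  by move=> x z z' _ hz hz'; apply: ext => p; rewrite hz hz'.
have [d hd] := zf_union ZF.1 r; exists d => p; rewrite hd; split.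
  move=> [z /hr[x xa rxz] /rxz[y [hp [ya Qxy]]]].
  by exists x, y.
move=> [x [y [hp [xa ya Qxy]]]].
have [||z hz] := @replacement (fun y p => is_opair E p x y /\ Q x y) a.
- definable_tac.
- by move=> y1 p1 p2 _ [h1 _] [h2 _]; apply: is_opair_uniq h1 h2.
have rxz : row x z.
  move=> q; rewrite hz; split=> [[y' y'a [hq Qxy']]|[y' [hq [y'a Qxy']]]].
    by exists y'.
  by exists y'.
by exists z; [apply/hr; exists x|apply/rxz; exists y].
Qed.


(** * Iteration along an inductive set; foundation for classes *)

Lemma in_asym x y : x ∈ y -> ~ y ∈ x.
Proof.
move=> xy yx; have [p hp] := zf_pair ZF.1 x y.
have [|z /hp[->|->] h] := zf_foundation ZF.1 (a := p).
- by exists x; apply/hp; left.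
- by apply: (h y) => //; apply/hp; right.
- by apply: (h x) => //; apply/hp; left.
Qed.

Definition successor n k := forall z, z ∈ n <-> z ∈ k \/ z = k.

Lemma successor_inj n k k' : successor n k -> successor n k' -> k = k'.
Proof.
move=> nk nk'.
have /nk' [|//] : k ∈ n by apply/nk; right.
have /nk [|//] : k' ∈ n by apply/nk'; right.
by move=> /in_asym.
Qed.

(** The iterates are indexed by the set [w] from Infinity, which need not be the least inductive
    set: an index that no derivation reaches contributes nothing. *)
Lemma iteration (F : U -> U -> Prop) a : definable2 F ->
  (forall u, exists v, F u v) -> (forall u v v', F u v -> F u v' -> v = v') ->
  exists b, a ∈ b /\ forall u v, u ∈ b -> F u v -> v ∈ b.
Proof.
move=> dF totF funF; have [w [[o ow o0] wS]] := zf_infinity ZF.1.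
(* A good set is a derivation: each of its pairs is initial or follows from another of its pairs by
   one application of [F]. It need not be a function; uniqueness of values is proved for [G]. *)
pose good g := forall p, p ∈ g ->
  (exists n, is_opair E p n a /\ n ∈ w /\ forall z, ~ z ∈ n) \/
  (exists n v q k u, is_opair E p n v /\ n ∈ w /\ is_opair E q k u /\
     q ∈ g /\ successor n k /\ F u v).
pose G n v := exists g p, good g /\ is_opair E p n v /\ p ∈ g.
have dgood : definable1 good by rewrite /good; definable_tac.
have dG : definable2 G by rewrite /G; definable_tac.
have G0 : G o a.
  have [p hp] := is_opair_ex o a; have [g hg] := singleton_ex p.
  exists g, p; split; last by split=> //; apply/hg.
  by move=> q /hg ->; left; exists o.
have GS n v k u : G k u -> n ∈ w -> successor n k -> F u v -> G n v.
  move=> [g [q [gg [hq qg]]]] nw nk uv.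
  have [p hp] := is_opair_ex n v; have [s hs] := singleton_ex p.
  have [g' hg'] := union2_ex g s.
  exists g', p; split; last by split=> //; apply/hg'; right; apply/hs.
  move=> r /hg'[/gg|/hs->].
    case=> [|[n' [v' [q' [k' [u' [h1 [h2 [h3 [h4 h5]]]]]]]]]]; first by left.
    by right; exists n', v', q', k', u'; do !split=> //; apply/hg'; left.
  by right; exists n, v, q, k, u; do !split=> //; apply/hg'; left.
have Gw n v : G n v -> n ∈ w /\ (((forall z, ~ z ∈ n) /\ v = a) \/
    exists k u, G k u /\ successor n k /\ F u v).
  move=> [g [p [gg [hp pg]]]]; case: (gg p pg).
    by move=> [m [/(is_opair_inj hp)[<- ->] [mw m0]]]; split=> //; left.
  move=> [m [v' [q [k [u]]]]].
  move=> [/(is_opair_inj hp)[<- <-] [mw [hq [qg [mk uv]]]]].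
  by split=> //; right; exists k, u; split=> //; exists g, q.
have Gfun n v v' : G n v -> G n v' -> v = v'.
  move=> Gv Gv'; apply: contrapT => vv'.
  (* A minimal index with two values is impossible: its predecessor is unique by [successor_inj],
     and so is the value there. *)
  have [|B hB] := @class_separation
    (fun n => exists v v', G n v /\ G n v' /\ v <> v') w; first definable_tac.
  have [|m /hB[_ [u [u' [Gu [Gu' uu']]]]] mB] := zf_foundation ZF.1 (a := B).
    by exists n; apply/hB; split; [case: (Gw _ _ Gv)|exists v, v'].
  case: (Gw _ _ Gu) => _ [[m0 ua]|[k [t [Gt [mk tu]]]]].
    case: (Gw _ _ Gu') => _ [[_ u'a]|[k [t [Gt [mk tu]]]]].
      by apply: uu'; rewrite ua u'a.
    by apply: (m0 k); apply/mk; right.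
  case: (Gw _ _ Gu') => _ [[m0 ua]|[k' [t' [Gt' [mk' tu']]]]].
    by apply: (m0 k); apply/mk; right.
  rewrite -(successor_inj mk mk') in Gt'.
  have tt' : t = t'.
    apply: contrapT => tt'; apply: (mB k); first by apply/mk; right.
    by apply/hB; split; [case: (Gw _ _ Gt)|exists t, t'].
  by apply: uu'; apply: funF tu _; rewrite tt'.
have [//|x y y' _|b hb] := @replacement G w; first exact: Gfun.
exists b; split; first by apply/hb; exists o.
move=> u v /hb[k kw Gu] uv; have [n nw nk] := wS _ kw.
by apply/hb; exists n => //; apply: GS Gu nw nk uv.
Qed.

(** Iterate the union operation from [x] and take the union of a set containing all iterates. *)
Lemma transitive_closure_ex x : exists t,
  (forall z, z ∈ x -> z ∈ t) /\ forall y z, y ∈ t -> z ∈ y -> z ∈ t.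
Proof.
have [|||b [xb hb]] :=
    @iteration (fun u v => forall z, z ∈ v <-> exists2 y, y ∈ u & z ∈ y) x.
- definable_tac.
- exact: zf_union ZF.1.
- by move=> u v v' hv hv'; apply: ext => z; rewrite hv hv'.
have [t ht] := zf_union ZF.1 b; exists t; split=> [z zx|y z].
  by apply/ht; exists x.
move=> /ht[u ub yu] zy; apply/ht.
have [v hv] := zf_union ZF.1 u.
by exists v; [apply: hb hv|apply/hv; exists y].
Qed.

(** Foundation for sets applies to the part of [Q] inside a transitive set that includes [x]; if
    that part is empty, [x] itself is minimal. *)
Lemma class_foundation (Q : U -> Prop) x : definable1 Q -> Q x ->
  exists2 y, Q y & forall z, z ∈ y -> ~ Q z.
Proof.
move=> dQ Qx; have [t [xt tt]] := transitive_closure_ex x.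
have [b hb] := class_separation t dQ.
case: (pselect (exists z, z ∈ b)) => [/(zf_foundation ZF.1)|b0].
  move=> [y /hb[yt Qy] yb]; exists y => // z zy Qz; apply: (yb z zy).
  by apply/hb; split=> //; apply: tt zy.
by exists x => // z zx Qz; apply: b0; exists z; apply/hb; split=> //; apply: xt.
Qed.

Lemma class_induction (Q : U -> Prop) : definable1 Q ->
  (forall x, (forall y, y ∈ x -> Q y) -> Q x) -> forall x, Q x.
Proof.
move=> dQ step x; apply: contrapT => nQx.
have [||y nQy hy] := @class_foundation (fun z => ~ Q z) x => //.
  definable_tac.
by apply: nQy; apply: step => z zy; apply: contrapT => /(hy z zy).
Qed.

(* A simulation d witnesses rank x <= rank y for each pair (x, y) in d. *)
Definition simulation d := forall p a b, p ∈ d -> is_opair E p a b ->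
  forall a', a' ∈ a -> exists b' q, b' ∈ b /\ is_opair E q a' b' /\ q ∈ d.

Definition rank_le x y :=
  exists d p, simulation d /\ is_opair E p x y /\ p ∈ d.

Lemma definable_rank_le : definable2 rank_le.
Proof. rewrite /rank_le; definable_tac. Qed.

(** For the converse, no simulations are chosen for the members of [x]: the pairs of [rank_le]
    inside a transitive set form, together with [(x, y)], a single simulation. *)
Lemma rank_leE x y :
  rank_le x y <-> forall x', x' ∈ x -> exists y', y' ∈ y /\ rank_le x' y'.
Proof.
have drank := definable_rank_le.
split.
  move=> [d [p [sd [hp pd]]]] x' x'x.
  have [y' [q [y'y [hq qd]]]] := sd _ _ _ pd hp _ x'x.
  by exists y'; split=> //; exists d, q.
move=> h.
have [u hu] := union2_ex x y.
have [t [ut tt]] := transitive_closure_ex u.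
have [d hd] := product_ex t drank.
have [p hp] := is_opair_ex x y.
have [s hs] := singleton_ex p; have [d' hd'] := union2_ex d s.
have d'I a b q :
    is_opair E q a b -> a ∈ t -> b ∈ t -> rank_le a b -> q ∈ d'.
  by move=> hq at' bt ab; apply/hd'; left; apply/hd; exists a, b.
exists d', p; split; last by split=> //; apply/hd'; right; apply/hs.
move=> q a b /hd'[/hd[a1 [b1 [hq1 [at' bt ab]]]]|/hs->] hq a' a'a.
  have [ea eb] := is_opair_inj hq hq1; subst a1 b1.
  case: ab => d1 [p1 [sd1 [hp1 pd1]]].
  have [b' [q' [b'b [hq' qd']]]] := sd1 _ _ _ pd1 hp1 _ a'a.
  exists b', q'; do 2!split=> //; apply: (d'I _ _ _ hq').
  - exact: tt at' a'a.
  - exact: tt bt b'b.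
  - by exists d1, q'.
have [ea eb] := is_opair_inj hq hp; subst a b.
have [b' [b'b a'b']] := h a' a'a; have [q' hq'] := is_opair_ex a' b'.
exists b', q'; do 2!split=> //; apply: (d'I _ _ _ hq' _ _ a'b').
- by apply: ut; apply/hu; left.
- by apply: ut; apply/hu; right.
Qed.

Lemma rank_le_refl x : rank_le x x.
Proof.
have drank := definable_rank_le.
move: x; apply: class_induction; first definable_tac.
by move=> x IH; apply/rank_leE => y yx; exists y; split=> //; apply: IH.
Qed.

Lemma rank_le_trans x y z : rank_le x y -> rank_le y z -> rank_le x z.
Proof.
have drank := definable_rank_le.
move: x y z; apply: class_induction; first definable_tac.
move=> x IH y z /rank_leE xy /rank_leE yz; apply/rank_leE => x' x'x.
have [y' [y'y x'y']] := xy _ x'x; have [z' [z'z y'z']] := yz _ y'y.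
by exists z'; split=> //; apply: IH x'y' y'z'.
Qed.

(** If some [x'] in [x] lies below no member of [y], induction at [x'] puts every member of [y]
    below a member of [x'], so [x'] is the witness. *)
Lemma rank_le_total x y : ~ rank_le x y ->
  exists x', x' ∈ x /\ rank_le y x'.
Proof.
have drank := definable_rank_le.
move: x y; apply: class_induction; first definable_tac.
move=> x IH y nxy; apply: contrapT => hx; apply: nxy.
apply/rank_leE => x' x'x; apply: contrapT => hy.
apply: hx; exists x'; split=> //; apply/rank_leE => y' y'y.
have [|x2 [x2x' y'x2]] := IH x' x'x y'; last by exists x2.
by move=> x'y'; apply: hy; exists y'.
Qed.

(** The set is a level of the cumulative hierarchy: the power set of the union of the levels for
    members of [y] bounds it. The power set axiom is applied only here. *)
Lemma rank_le_set y : exists s, forall x, x ∈ s <-> rank_le x y.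
Proof.
have drank := definable_rank_le.
move: y; apply: class_induction; first definable_tac.
move=> y IH.
have [||r hr] :=
  @replacement (fun y' s => forall x, x ∈ s <-> rank_le x y') y.
- definable_tac.
- by move=> y' s s' _ hs hs'; apply: ext => x; rewrite hs hs'.
have [u hu] := zf_union ZF.1 r; have [v hv] := ZF.2 u.
have [|s hs] := @class_separation (fun x => rank_le x y) v.
  definable_tac.
exists s => x; rewrite hs; split=> [[]//|xy]; split=> //.
apply/hv => x' x'x; move/rank_leE: xy => /(_ _ x'x)[y' [y'y x'y']].
have [s' hs'] := IH y' y'y; apply/hu; exists s'; last exact/hs'.
by apply/hr; exists y'.
Qed.

(* Scott's trick. *)
Lemma minimal_rank_set (Q : U -> Prop) c : definable1 Q -> Q c ->
  exists s, (exists x, x ∈ s) /\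
    forall x, x ∈ s <-> Q x /\ forall y, Q y -> rank_le x y.
Proof.
move=> dQ Qc; have drank := definable_rank_le.
have [l [Ql ll]] : exists l, Q l /\ forall y, Q y -> rank_le l y.
  apply: contrapT => nol.
  (* Without a least rank, induction on [x] shows that no member of [Q] has rank at most that of
     [x]; reflexivity refutes this at [c]. *)
  suff : forall x, ~ exists c, Q c /\ rank_le c x.
    move=> /(_ c); apply; exists c; split=> //.
    exact: rank_le_refl.
  apply: class_induction; first definable_tac.
  move=> x IH [d [Qd dx]]; apply: nol; exists d; split=> // y Qy.
  apply: contrapT => /rank_le_total[d' [d'd yd']].
  move/rank_leE: dx => /(_ _ d'd)[x' [x'x d'x']].
  by apply: (IH x' x'x); exists y; split=> //; apply: rank_le_trans yd' d'x'.
have [v hv] := rank_le_set l.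
have [|s hs] := @class_separation
  (fun x => Q x /\ forall y, Q y -> rank_le x y) v; first definable_tac.
have sE x : x ∈ s <-> Q x /\ forall y, Q y -> rank_le x y.
  by rewrite hs; split=> [[]//|[Qx xl]]; split=> //; apply/hv/xl.
by exists s; split=> //; exists l; apply/sE.
Qed.


(** * Absoluteness of well-foundedness, transitive closure and recursion *)

Definition set_wf (R : set U) := forall b, (exists x, x ∈ b) ->
  exists2 x, x ∈ b & forall y, y ∈ b -> ~ crel E R y x.

(* If a nonempty class has no R-minimal element, then so does the set of its
   members obtained by closing a singleton under R-predecessors of minimal
   rank. *)
Lemma class_wfE (R : set U) : X R -> class_wf E X R <-> set_wf R.
Proof.
move=> XR'; split=> [wfR b|wfR A XA [x0 Ax0]].
  by apply: (wfR (fun x => x ∈ b)); apply: (comprehension XC); definable_tac.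
apply: contrapT => noMin.
have pred x : A x -> exists y, A y /\ crel E R y x.
  move=> Ax; apply: contrapT => h; apply: noMin; exists x => // y Ay yx.
  by apply: h; exists y.
have drank := definable_rank_le.
pose minpred x y := (A y /\ crel E R y x) /\
  forall y', A y' /\ crel E R y' x -> rank_le y y'.
have dmin : definable2 minpred by rewrite /minpred; definable_tac.
pose F u v := forall y, y ∈ v <-> exists x, x ∈ u /\ A x /\ minpred x y.
have Ftot u : exists v, F u v.
  have [||r hr] := @replacement
    (fun x s => A x /\ forall y, y ∈ s <-> minpred x y) u.
  - definable_tac.
  - by move=> x s s' _ [_ hs] [_ hs']; apply: ext => y; rewrite hs hs'.
  have [v hv] := zf_union ZF.1 r; exists v => y; rewrite hv; split.
    by move=> [s /hr[x xu [Ax hs]] /hs ys]; exists x.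
  move=> [x [xu [Ax xy]]]; have [c hc] := pred x Ax.
  have [|s [_ hs]] := @minimal_rank_set (fun y => A y /\ crel E R y x) c _ hc.
    definable_tac.
  by exists s; [apply/hr; exists x|apply/hs].
have [a ha] := singleton_ex x0.
have dF : definable2 F by rewrite /F; definable_tac.
have funF u v v' : F u v -> F u v' -> v = v'.
  by move=> hv hv'; apply: ext => z; rewrite hv hv'.
have [b [ab hb]] := iteration a dF Ftot funF.
have [u hu] := zf_union ZF.1 b.
(* [iteration] does not bound [b] from above, so its union must be cut down to [A]. *)
have [|c hc] := @class_separation A u; first definable_tac.
have [|x /hc[/hu[v vb xv] Ax] xmin] := wfR c.
  by exists x0; apply/hc; split=> //; apply/hu; exists a => //; apply/ha.
have [y0 hy0] := pred x Ax.
have [|s [[y ys] hs]] :=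
  @minimal_rank_set (fun y => A y /\ crel E R y x) y0 _ hy0; first definable_tac.
have /hs[[Ay yx] ymin] := ys.
apply: (xmin y) => //; apply/hc; split=> //; apply/hu.
have [v' hv'] := Ftot v; exists v'; first exact: hb hv'.
by apply/hv'; exists x.
Qed.

(* A path from a to b inside the set c is expressed without finite sequences:
   a lies in every set d containing all predecessors of b within c and closed
   under predecessors within c. *)
Definition set_tclosure (R : set U) a b := exists c, a ∈ c /\ b ∈ c /\
  forall d, (forall x, x ∈ c -> crel E R x b -> x ∈ d) ->
    (forall x y, x ∈ c -> y ∈ c -> y ∈ d -> crel E R x y -> x ∈ d) -> a ∈ d.

Lemma definable_set_tclosure (R : set U) : X R -> definable2 (set_tclosure R).
Proof. move=> XR'; rewrite /set_tclosure; definable_tac. Qed.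

Lemma set_tclosure_incl (R : set U) x y : crel E R x y -> set_tclosure R x y.
Proof.
move=> xy; have [c hc] := zf_pair ZF.1 x y; exists c.
have xc : x ∈ c by apply/hc; left.
by split=> //; split=> [|d hd _]; [apply/hc; right|apply: hd].
Qed.

Lemma set_tclosure_trans (R : set U) x y z :
  set_tclosure R x y -> set_tclosure R y z -> set_tclosure R x z.
Proof.
move=> [c1 [xc1 [yc1 h1]]] [c2 [yc2 [zc2 h2]]].
have [c hc] := union2_ex c1 c2.
have sub1 u : u ∈ c1 -> u ∈ c by move=> uc; apply/hc; left.
have sub2 u : u ∈ c2 -> u ∈ c by move=> uc; apply/hc; right.
exists c; split; first exact: sub1.
split=> [|d dz dcl]; first exact: sub2.
(* The path from [y] to [z] puts [y] in [d]; then [d] also contains the predecessors of [y] in [c1]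
   and qualifies for the path from [x] to [y]. *)
have yd : y ∈ d.
  apply: h2 => [u /sub2 uc|u v /sub2 uc /sub2 vc]; first exact: dz.
  exact: dcl.
apply: h1 => [u /sub1 uc uy|u v /sub1 uc /sub1 vc]; last exact: dcl.
by apply: dcl uy => //; apply: sub1.
Qed.

(** [set_tclosure R] is itself a transitive class relation of [X] extending [R]. Conversely, given
    any such [T], the members of [c] that are [T]-below [b] form a test set [d]. *)
Lemma tclosureE (R : set U) a b : X R -> class_relation E R ->
  tclosure E X R a b <-> set_tclosure R a b.
Proof.
move=> XR' relR; have dT := definable_set_tclosure XR'; split.
  pose T : set U := fun p => exists x y, is_opair E p x y /\ set_tclosure R x y.
  have TE x y : crel E T x y <-> set_tclosure R x y.
    split=> [[p hp [x' [y' [hp']]]]|h].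
      by have [-> ->] := is_opair_inj hp hp'.
    by have [p hp] := is_opair_ex x y; exists p => //; exists x, y.
  move=> /(_ T) h; apply/TE; apply: h.
  - by apply: (comprehension XC); rewrite /T; definable_tac.
  - by move=> p [x [y [hp _]]]; exists x, y.
  - by move=> x y z /TE xy /TE yz; apply/TE; apply: set_tclosure_trans yz.
  - move=> p Rp; have [x [y hp]] := relR p Rp; exists x, y; split=> //.
    by apply: set_tclosure_incl; exists p.
move=> [c [ac [bc h]]] T XT relT transT RT.
have RT' x y : crel E R x y -> crel E T x y by move=> [p hp /RT]; exists p.
have [|d hd] := @class_separation (fun x => crel E T x b) c; first definable_tac.
have /hd[//] : a ∈ d.
apply: h => [x xc /RT' xb|x y xc yc /hd[_ yb] /RT' xy]; apply/hd; split=> //.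
exact: transT xy yb.
Qed.

(** Splits off the last edge of a path, because minimality in [class_wf] speaks of [R] and not of
    its closure. *)
Lemma set_tclosure_last (R : set U) a b : X R -> class_relation E R ->
  set_tclosure R a b ->
  exists s, crel E R s b /\ (a = s \/ set_tclosure R a s).
Proof.
move=> XR' relR [c [ac [bc h]]]; have dT := definable_set_tclosure XR'.
have [|d hd] := @class_separation
  (fun x => exists s, crel E R s b /\ (x = s \/ set_tclosure R x s)) c.
  definable_tac.
have /hd[//] : a ∈ d.
apply: h => [x xc xb|x y xc yc /hd[_ [s [sb ys]]] xy]; apply/hd; split=> //.
  by exists x; split=> //; left.
exists s; split=> //; right; case: ys => [<-|ys].
  exact: set_tclosure_incl.
exact: set_tclosure_trans (set_tclosure_incl xy) ys.
Qed.

(** [X] enters only through the transitive closure in [restr], so a solution found in one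
    realization can be read in another. *)
Definition recursion_solution (f : fml 2 1) (A R S : set U) :=
  (forall p, S p -> exists r x, rel_dom E R r /\ is_opair E p r x) /\
  forall r, rel_dom E R r ->
    section E S r = [set x | sat E [tuple restr E X R S r; A] f [tuple x]].

Lemma recursion_solution_uniq (f : fml 2 1) (A R S S' : set U) :
  X R -> X S -> X S' -> class_relation E R -> class_wf E X R ->
  recursion_solution f A R S -> recursion_solution f A R S' -> S = S'.
Proof.
move=> XR' XS XS' relR wfR [domS solS] [domS' solS'].
have dT := definable_set_tclosure XR'.
pose differ r := exists x, ~ (crel E S r x <-> crel E S' r x).
(* An [R]-minimal point of [differ] could still have disagreement further down along the closure.
   [D] also contains the points above a disagreement, so at a minimal point of [D] everything below
   agrees. *)
pose D : set U := fun r => rel_dom E R r /\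
  exists r', differ r' /\ (r' = r \/ set_tclosure R r' r).
have ddiffer : definable1 differ by rewrite /differ; definable_tac.
have XD : X D.
  by apply: (comprehension XC); rewrite /D /rel_dom /mkset; definable_tac.
have agree r : rel_dom E R r -> ~ differ r.
  move=> domr dr; have [|m [domm [r' [dr' r'm]]] mD] := wfR D XD.
    by exists r; split=> //; exists r; split=> //; left.
  have below s : set_tclosure R s m -> ~ differ s.
    move=> /(set_tclosure_last XR' relR)[t [tm st]] ds.
    by apply: (mD t) => //; split; [exists m; left|exists s].
  case: r'm => [r'm|/below//]; subst r'; case: dr' => x; apply.
  have restrE S1 S2 : (forall s y, set_tclosure R s m ->
      crel E S1 s y <-> crel E S2 s y) -> restr E X R S1 m `<=` restr E X R S2 m.
    move=> S12 p [Sp [s [y [hp doms sm]]]]; split; last by exists s, y.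
    by apply/(crel_opair _ hp)/S12; [apply/tclosureE|apply/(crel_opair _ hp)].
  have eq_below s y : set_tclosure R s m -> crel E S s y <-> crel E S' s y.
    by move=> /below sm; apply: contrapT => h; apply: sm; exists y.
  have restrSS' : restr E X R S m = restr E X R S' m.
    by apply/seteqP; split; apply: restrE => s y /(eq_below s y)[].
  have := solS m domm; rewrite restrSS' -(solS' m domm) => /seteqP[h h'].
  by split; [apply: h|apply: h'].
have incl S1 S2 :
    (forall r x, rel_dom E R r -> crel E S1 r x -> crel E S2 r x) ->
    (forall p, S1 p -> exists r x, rel_dom E R r /\ is_opair E p r x) ->
    S1 `<=` S2.
  move=> S12 dom1 p S1p; have [r [x [domr hp]]] := dom1 p S1p.
  by apply/(crel_opair _ hp)/S12 => //; apply/(crel_opair _ hp).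
have eqr r x : rel_dom E R r -> crel E S r x <-> crel E S' r x.
  by move=> /agree dr; apply: contrapT => h; apply: dr; exists x.
by apply/seteqP; split; apply: incl => // r x /(eqr r x)[].
Qed.

End SetTheory.

(** * Intersections of realizations *)

Lemma restr_absolute (U : Type) (E : U -> U -> Prop) (X X' : set (set U))
    (R S : set U) r :
  ZFC E -> class_replacement E X -> elementary_comprehension E X ->
  class_replacement E X' -> elementary_comprehension E X' ->
  X R -> X' R -> class_relation E R -> restr E X R S r = restr E X' R S r.
Proof.
move=> ZF RX CX RX' CX' XR XR' relR; apply/seteqP.
by split=> p [Sp [s [y [hp ds /tclosureE sr]]]]; split=> //; exists s, y;
  split=> //; apply/tclosureE => //; apply: sr.
Qed.

(* GBcETR contains ZFC, which depends only on E, so a GBcminus-amalgam of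
   realizations for a model of ZFC satisfies GBc. *)
Lemma GBcETR_bigcap (U : Type) (E : U -> U -> Prop) (Z : set (set U))
    (F : set (set (set U))) :
  ZFC E -> GBcminus E Z -> (exists X, F X) ->
  (forall X, F X -> GBcETR E X /\ X `<=` Z) ->
  GBcETR E (\bigcap_(X in F) X).
Proof.
move=> ZF [_ _ ZR ZC] [X0 FX0] hF; set W := \bigcap_(X in F) X.
have [[[_ _ RX0 CX0] etrX0] X0Z] := hF X0 FX0.
have WX0 : W `<=` X0 by move=> A; apply.
have WR : class_replacement E W by move=> G a /WX0; apply: RX0.
have WC : elementary_comprehension E W.
  move=> m n f P p WP; have [C X0C hC] := CX0 m n f P p (fun i => WX0 _ (WP i)).
  exists C => // X FX; have [[[_ _ _ CX] _] _] := hF X FX.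
  have [C' XC' hC'] := CX m n f P p (fun i => WP i X FX).
  suff -> : C = C' by [].
  by apply/funext => x; apply/propext; rewrite hC hC'.
split; first by split=> // A B _ _ h; apply/funext => x; apply/propext.
move=> f A R WA WR' relR /(class_wfE ZF WR WC WR') wfR.
(* Each member's solution is restated with [restr] computed in [Z], where all solutions can be
   compared. *)
have solX X : F X -> exists2 S, X S & recursion_solution E Z f A R S.
  move=> FX; have [[[_ _ RX CX] etrX] XZ] := hF X FX.
  have XR : X R by apply: WR'.
  have [|S [XS domS solS]] := etrX f A R (WA X FX) XR relR.
    exact/(class_wfE ZF RX CX XR).
  exists S => //; split=> // r domr.
  by rewrite solS // (restr_absolute S r ZF RX CX ZR ZC XR (XZ _ XR) relR).
have ZR' : Z R by apply/X0Z/WX0.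
have [S X0S solS] := solX X0 FX0.
exists S; split; last 2 first.
- by case: solS.
- move=> r domr; case: solS => _ ->//.
  by rewrite (restr_absolute S r ZF WR WC ZR ZC WR' ZR' relR).
move=> X FX; have [S' XS' solS'] := solX X FX.
have -> // : S = S'.
apply: (recursion_solution_uniq ZF ZR ZC ZR' _ _ relR _ solS solS').
- exact: X0Z.
- by have [_ XZ] := hF X FX; apply: XZ.
- exact/(class_wfE ZF ZR ZC ZR').
Qed.

(** * The basis of minimal realizations *)

Section Basis.
Variables (U : Type) (E : U -> U -> Prop).
Hypothesis ZF : ZFC E.

(** Only realizations inside [Y] are intersected, so a realization [Y] serves as their common
    extension in [GBcETR_bigcap]. *)
Definition core (Y : set (set U)) : set (set U) :=
  \bigcap_(X in [set X | GBcETR E X /\ X `<=` Y]) X.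

Lemma GBcminus_of_GBcETR Y : GBcETR E Y -> GBcminus E Y.
Proof. by move=> [[[? _] ? ? ?] _]. Qed.

Lemma core_sub Y : GBcETR E Y -> core Y `<=` Y.
Proof. by move=> hY A h; apply: h; split. Qed.

Lemma core_min Y X : GBcETR E X -> X `<=` Y -> core Y `<=` X.
Proof. by move=> hX XY A h; apply: h; split. Qed.

Lemma core_GBcETR Y : GBcETR E Y -> GBcETR E (core Y).
Proof.
move=> hY; apply: (GBcETR_bigcap ZF (GBcminus_of_GBcETR hY)) => //.
by exists Y; split.
Qed.

Lemma core_minimal Y : GBcETR E Y -> minimal_realization (GBcETR E) (core Y).
Proof.
move=> hY; split; first exact: core_GBcETR.
move=> X hX XY; apply/seteqP; split=> //; apply: core_min => //.
exact: subset_trans XY (core_sub hY).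
Qed.

Lemma amalgamable_inter X Y : GBcETR E X -> GBcETR E Y -> amalgamable E X Y ->
  exists B, [/\ GBcETR E B, B `<=` X & B `<=` Y].
Proof.
move=> hX hY [Z [hZ XZ YZ]].
exists (\bigcap_(T in [set T | T = X \/ T = Y]) T); split.
- apply: (GBcETR_bigcap ZF hZ); first by exists X; left.
  by move=> T [->|->].
- by move=> A; apply; left.
- by move=> A; apply; right.
Qed.

(** By minimality, a realization below both equals each of them. *)
Lemma minimal_amalgamable_eq B C : minimal_realization (GBcETR E) B ->
  minimal_realization (GBcETR E) C -> amalgamable E B C -> B = C.
Proof.
move=> [hB minB] [hC minC] /(amalgamable_inter hB hC)[D [hD DB DC]].
by rewrite -(minB D hD DB) (minC D hD DC).
Qed.

End Basis.

Theorem theorem4p8 (M : Type) (E : M -> M -> Prop)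
    (hM : ZFC E) (hreal : realizable (GBcETR E)) :
  exists Bs : set (set (set M)),
    [/\ (forall B, Bs B -> minimal_realization (GBcETR E) B),
        (forall B C, Bs B -> Bs C -> B <> C -> ~ amalgamable E B C),
        (forall Y, GBcETR E Y -> exists! B, Bs B /\ B `<=` Y)
      & (forall X Y, GBcETR E X -> GBcETR E Y -> amalgamable E X Y ->
           exists B, [/\ Bs B, B `<=` X & B `<=` Y])].
Proof.
exists (minimal_realization (GBcETR E)).
split=> // [B C mB mC BC BCam|Y hY|X Y hX hY XY].
- exact/BC/(minimal_amalgamable_eq hM).
- exists (core E Y); split.
    by split; [apply: core_minimal|apply: core_sub].
  move=> B [mB BY]; apply: (minimal_amalgamable_eq hM) => //.
    exact: core_minimal.
  (* [Y] itself amalgamates [B] and [core E Y]. *)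
  exists Y; split=> //; first exact: GBcminus_of_GBcETR.
  exact: core_sub.
- have [B [hB BX BY]] := amalgamable_inter hM hX hY XY.
  exists (core E B); split; first exact: core_minimal.
    exact: subset_trans (core_sub hB) BX.
  exact: subset_trans (core_sub hB) BY.
Qed.
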